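(* Let $X$ be a reflexive Banach space over $\mathbb R$, $Y$ a Banach space over $\mathbb R$, $\Lambda$ a directed set, $\{X_\lambda\}_{\lambda\in\Lambda}$ a family of closed subspaces of $X$, $\{Y_\lambda\}_{\lambda\in\Lambda}$ an upwards directed family of closed subspaces of $Y$, and $V=\bigcup_{\lambda\in\Lambda}Y_\lambda$. Suppose that $A:X\times V\longrightarrow\mathbb R$ is a function for which the following hold: (a) $A_\lambda=A|_{X_\lambda\times Y_\lambda}$ is a bounded bilinear form, for all $\lambda\in\Lambda$. (b) $A(\cdot,v)$ is a bounded linear functional on $X$, for all $v\in V$. (c) $A_\lambda$ is non-degenerate with respect to the second variable, for all $\lambda\in\Lambda$; that is, for each $y\in Y_\lambda\setminus\{0\}$ there exists $x\in X_\lambda$ with $A_\lambda(x,y)\neq 0$. (d) There exists $c>0$ such that, for all $\lambda\in\Lambda$, $$\sup_{y\in Y_\lambda,\ \|y\|=1}|A_\lambda(x,y)|\geq c\|x\|,\quad\text{for all } x\in X_\lambda.$$ Then, for each bounded linear functional $v^*$ on $V$, there exists $x\in X$ such that $$A(x,v)=\langle v^*,v\rangle,\quad\text{for all } v\in V.$$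
   Context: All Banach spaces are over $\mathbb R$. $\langle\cdot,\cdot\rangle$ denotes the duality pairing, so $\langle v^*,v\rangle=v^*(v)$. A family $\{Y_\lambda\}_{\lambda\in\Lambda}$ of subspaces indexed by a directed set $\Lambda$ is upwards directed if $\lambda\leq\mu$ implies $Y_\lambda\subseteq Y_\mu$; hence $V$ is a linear subspace of $Y$, and it is equipped with the norm of $Y$. No such monotonicity is required of the family $\{X_\lambda\}_{\lambda\in\Lambda}$. *)

(* Defs.v *)
From HB Require Import structures.
From mathcomp Require Import all_boot all_order all_algebra.
From mathcomp Require Import all_classical all_reals all_analysis.

Set Implicit Arguments.
Unset Strict Implicit.
Unset Printing Implicit Defensive.

Import Order.TTheory GRing.Theory Num.Theory.
Import numFieldNormedType.Exports.

Local Open Scope classical_set_scope.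
Local Open Scope ring_scope.

(* Maps out of a subspace W of E (linear forms on W, and bilinear forms on     *)
(* U x W) are represented by total functions on the ambient spaces. Every      *)
(* predicate below only looks at values on W, resp. U x W.                     *)

Definition closed_subspace (R : realType) (E : normedModType R) (W : set E) :=
  closed W /\ submod_closed (mem W).

Definition linear_on (R : realType) (E : normedModType R) (W : set E)
    (f : E -> R) :=
  forall (a : R) (u v : E), W u -> W v -> f (a *: u + v) = a * f u + f v.

Definition bounded_linear_functional (R : realType) (E : normedModType R)
    (W : set E) (f : E -> R) :=
  linear_on W f /\ exists M : R, forall u, W u -> `|f u| <= M * `|u|.

Definition bounded_bilinear_form (R : realType) (E F : normedModType R)
    (U : set E) (W : set F) (B : E -> F -> R) :=
  [/\ forall w, W w -> linear_on U (B ^~ w),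
      forall u, U u -> linear_on W (B u) &
      exists M : R, forall u w, U u -> W w -> `|B u w| <= M * `|u| * `|w|].

Definition nondegenerate_snd (R : realType) (E F : normedModType R)
    (U : set E) (W : set F) (B : E -> F -> R) :=
  forall w, W w -> w != 0 -> exists2 u, U u & B u w != 0.

Definition directed_set (L : Type) (le : L -> L -> Prop) :=
  [/\ inhabited L,
      forall l, le l l,
      forall l m n, le l m -> le m n -> le l n &
      forall l m, exists2 n, le l n & le m n].

Definition upwards_directed (L : Type) (le : L -> L -> Prop) (T : Type)
    (Y : L -> set T) :=
  forall l m, le l m -> Y l `<=` Y m.

Section dual_predicate.
Context {R : realType} {E : normedModType R}.

Definition dual_pred : {pred (E -> R^o)} :=
  fun f => `[< bounded_linear_functional setT f >].

Lemma dual_pred_submod_closed : submod_closed dual_pred.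
Proof.
split.
  apply/asboolP; split; first by move=> a u v _ _; rewrite /= mulr0 addr0.
  by exists 0 => u _; rewrite normr0 mul0r.
move=> a f g /asboolP[fl [M fM]] /asboolP[gl [N gN]]; apply/asboolP; split.
  move=> b u v _ _; rewrite /= !fctE /= fl// gl//.
  by rewrite /GRing.scale /= !mulrDr addrACA !mulrA (mulrC a b).
exists (`|a| * M + N) => u _; rewrite /= !fctE mulrDl.
rewrite (le_trans (ler_normD _ _))// lerD//; last exact: gN.
by rewrite normrM -mulrA ler_wpM2l// fM.
Qed.

HB.instance Definition _ :=
  GRing.isSubmodClosed.Build R (E -> R^o) dual_pred dual_pred_submod_closed.

End dual_predicate.

Record dual (R : realType) (E : normedModType R) := Dual {
  dual_fun :> E -> R^o;
  _ : dual_fun \in dual_pred }.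

Section dual_normedModType.
Context {R : realType} {E : normedModType R}.

HB.instance Definition _ := [isSub for @dual_fun R E].
HB.instance Definition _ := [Choice of dual E by <:].
HB.instance Definition _ := [SubChoice_isSubLmodule of dual E by <:].

Lemma dual_functional (f : dual E) : bounded_linear_functional setT f.
Proof. by case: f => f /= /asboolP. Qed.

Definition dual_norm (f : dual E) : R :=
  sup [set `|f u| | u in [set u : E | `|u| <= 1]].

Lemma dual_linear (f : dual E) (a : R) u v :
  f (a *: u + v) = a * f u + f v.
Proof. by have [fl _] := dual_functional f; exact: fl. Qed.

Lemma dual0 (f : dual E) : f 0 = 0.
Proof.
by have := dual_linear f (-1) 0 0; rewrite scaler0 addr0 mulN1r addNr.
Qed.

Lemma dualZ (f : dual E) (a : R) u : f (a *: u) = a * f u.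
Proof. by have := dual_linear f a u 0; rewrite !addr0 dual0 addr0. Qed.

Lemma dual_norm_has_sup (f : dual E) :
  has_sup [set `|f u| | u in [set u : E | `|u| <= 1]].
Proof.
split; first by exists `|f 0|, 0 => //=; rewrite normr0.
have [_ [M fM]] := dual_functional f; exists `|M| => _ [u /= u1 <-].
rewrite (le_trans (fM u Logic.I))// (le_trans (ler_norm _))// normrM normr_id.
by rewrite ler_piMr.
Qed.

Lemma dual_norm_ge (f : dual E) u : `|u| <= 1 -> `|f u| <= dual_norm f.
Proof.
move=> u1; apply: sup_upper_bound; first exact: dual_norm_has_sup.
by exists u.
Qed.

Lemma dual_norm_le (f : dual E) M :
  (forall u, `|u| <= 1 -> `|f u| <= M) -> dual_norm f <= M.
Proof.
move=> fM; apply: ge_sup; first by case: (dual_norm_has_sup f).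
by move=> _ [u /= u1 <-]; exact: fM.
Qed.

Lemma dual_norm_ge0 (f : dual E) : 0 <= dual_norm f.
Proof. by apply: le_trans (@dual_norm_ge f 0 _); rewrite ?normr0. Qed.

Lemma dual_normP (f : dual E) u : `|f u| <= dual_norm f * `|u|.
Proof.
have [->|u0] := eqVneq u 0; first by rewrite dual0 !normr0 mulr0.
have nu : 0 < `|u| by rewrite normr_gt0.
rewrite -ler_pdivrMr// mulrC -[`|u|^-1]ger0_norm ?invr_ge0// -normrM -dualZ.
by apply: dual_norm_ge; rewrite normrZ normfV normr_id mulVf// gt_eqF.
Qed.

Lemma dual_norm_eq0 (f : dual E) : dual_norm f = 0 -> f = 0.
Proof.
move=> f0; apply/val_inj/funext => u /=; apply/eqP; rewrite -normr_le0.
by rewrite (le_trans (dual_normP f u))// f0 mul0r.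
Qed.

Lemma dual_normD (f g : dual E) :
  dual_norm (f + g) <= dual_norm f + dual_norm g.
Proof.
apply: dual_norm_le => u u1; rewrite (le_trans (ler_normD (f u) (g u)))//.
by rewrite lerD// dual_norm_ge.
Qed.

Lemma dual_normZ_le (a : R) (f : dual E) :
  dual_norm (a *: f) <= `|a| * dual_norm f.
Proof.
apply: dual_norm_le => u u1.
by rewrite [leLHS](normrM a (f u)) ler_wpM2l// dual_norm_ge.
Qed.

Lemma dual_normZ (a : R) (f : dual E) :
  dual_norm (a *: f) = `|a| * dual_norm f.
Proof.
apply/eqP; rewrite eq_le dual_normZ_le/=.
have [->|a0] := eqVneq a 0; first by rewrite normr0 mul0r dual_norm_ge0.
rewrite -ler_pdivlMl ?normr_gt0// -normfV.
by have := dual_normZ_le a^-1 (a *: f); rewrite scalerA mulVf// scale1r.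
Qed.

HB.instance Definition _ :=
  Lmodule_isNormed.Build R (dual E) dual_normD dual_normZ dual_norm_eq0.

Lemma dual_normE (f : dual E) :
  `|f| = sup [set `|f u| | u in [set u : E | `|u| <= 1]].
Proof. by []. Qed.

End dual_normedModType.

Section reflexive.
Context {R : realType}.

Lemma evaluation_in_dual (E : normedModType R) (x : E) :
  (fun f : dual E => f x : R^o) \in dual_pred.
Proof.
apply/asboolP; split => //; exists `|x| => f _.
by rewrite mulrC; exact: dual_normP.
Qed.

Definition canonical_embedding (E : normedModType R) (x : E) : dual (dual E) :=
  Dual (evaluation_in_dual x).

Definition reflexive_space (E : normedModType R) :=
  set_surj [set: E] [set: dual (dual E)] (@canonical_embedding E).

End reflexive.

(* Main.v *)
Require Import Defs.
From HB Require Import structures.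
From mathcomp Require Import all_boot all_order all_algebra.
From mathcomp Require Import all_classical all_reals all_analysis.
From mathcomp Require Import ring lra.

Set Implicit Arguments.
Unset Strict Implicit.
Unset Printing Implicit Defensive.

Import Order.TTheory GRing.Theory Num.Theory.
Import numFieldNormedType.Exports.

Local Open Scope classical_set_scope.
Local Open Scope ring_scope.

(* On each pair (X_l, Y_l), hypothesis (d), the reflexivity of X and a         *)
(* Hahn-Banach separation show that the functionals A(., w), with w in the     *)
(* unit ball of Y_l, are norm dense in the ball of radius c of the dual of     *)
(* X_l. Successive approximation (Y_l is complete) followed by non-degeneracy  *)
(* turns this into the adjoint estimate c |w| <= 4 |A(., w)|, the norm being   *)
(* taken on X_l. The constant does not depend on l, so for v1, ..., vn in V    *)
(* and K = 4 |v*| / c,                                                         *)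
(*   |sum_i a_i v*(v_i)| <= K |sum_i a_i A(., v_i)|,                           *)
(* and by Hahn-Banach (Helly's theorem) some element of the bidual, that is,   *)
(* some x in X, satisfies A(x, v) = v*(v).                                     *)

(** Hypothesis (d) bounds x in X_l by the functional A(x, .) on Y_l; solving for x needs the
    transposed bound, of w in Y_l by A(., w) on X_l. [approximation] derives near-surjectivity of w
    |-> A(., w) from (d) by separation, the separating functional being a point of X by reflexivity.
    [inf_sup] iterates this, and non-degeneracy forces the limit of the iteration to be 0. Since the
    bound is uniform in l, A(., v) |-> v*(v) is bounded on a subspace of the dual of X; a
    Hahn-Banach extension of it is evaluation at a point x, again by reflexivity
    ([reflexive_cone]). *)

Section hahn_banach.
Context {R : realType} {E : lmodType R}.
Implicit Types (C : set (E * R)) (x y f : E) (s t : R).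

Definition linear_form (Phi : E -> R) :=
  forall a x y, Phi (a *: x + y) = a * Phi x + Phi y.

(* Stands for the epigraph of a sublinear functional: the Hahn-Banach theorem *)
(* yields a linear form [Phi] with [Phi x <= t] for all [(x, t)] in [C].      *)
Definition epigraph_cone C :=
  [/\ forall a x t, 0 <= a -> C (x, t) -> C (a *: x, a * t),
      forall x y s t, C (x, s) -> C (y, t) -> C (x + y, s + t) &
      forall t, C (0, t) -> 0 <= t].

Definition total_cone C := forall x, exists t, C (x, t).

(** The cone generated by [C] and the ray through [(- f, - s)]; a form lying below it satisfies
    [s <= Phi f]. *)
Definition adjoin C f s : set (E * R) :=
  [set p | exists2 r, 0 <= r & C (p.1 + r *: f, p.2 + r * s)].

Lemma sub_adjoin C f s : C `<=` adjoin C f s.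
Proof. by move=> [x t] Cxt; exists 0; rewrite //= scale0r mul0r !addr0. Qed.

Lemma adjoin_generator C f s : C (0, 0) -> adjoin C f s (- f, - s).
Proof. by move=> C0; exists 1; rewrite //= scale1r mul1r !addNr. Qed.

(** Only nonnegativity over 0 is at stake: a point [(0, t)] comes from [(r *: f, t + r * s)] in [C],
    and dividing by [r] gives [s <= t / r + s]. *)
Lemma epigraph_cone_adjoin C f s : epigraph_cone C ->
  (forall t, C (f, t) -> s <= t) -> epigraph_cone (adjoin C f s).
Proof.
move=> [CZ CD C0] Cf; split => [a x t a0 [r r0 /= Cr]||t [r r0 /= Cr]].
- exists (a * r); first exact: mulr_ge0.
  by rewrite /= -scalerA -scalerDr -mulrA -mulrDr; exact: CZ.
- move=> x y s1 s2 [r1 r10 /= C1] [r2 r20 /= C2].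
  exists (r1 + r2); first exact: addr_ge0.
  by rewrite /= scalerDl mulrDl addrACA (addrACA s1); exact: CD.
- have [rE|rN0] := eqVneq r 0.
    by move: Cr; rewrite rE scale0r mul0r !addr0; exact: C0.
  have r_gt0 : 0 < r by rewrite lt_def rN0.
  have rV0 : 0 <= r^-1 by rewrite invr_ge0.
  have := CZ _ _ _ rV0 Cr.
  rewrite add0r scalerA mulVf// scale1r => /Cf.
  by rewrite mulrDr mulrA mulVf// mul1r lerDr pmulr_rge0 ?invr_gt0.
Qed.

Lemma maximal_cone C : epigraph_cone C -> C (0, 0) ->
  exists M, [/\ C `<=` M, epigraph_cone M &
    forall N, epigraph_cone N -> M `<=` N -> N `<=` M].
Proof.
move=> coneC C00.
pose P M := M = set0 \/ C `<=` M /\ epigraph_cone M.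
have [F FP Ftot|M [PM Mmax]] := @Zorn_bigcup _ P.
  have inF M p : F M -> M p -> C `<=` M /\ epigraph_cone M.
    by move=> /FP[->//|].
  have [[p [N FN Np]]|/set0P/negP/negPn/eqP->] :=
    pselect (\bigcup_(M in F) M !=set0); last by left.
  right; split=> [q Cq|].
    by exists N => //; have [CN _] := inF _ _ FN Np; exact: CN.
  split=> [a x t a0 [N1 FN1 N1x]
          |x y s t [N1 FN1 N1x] [N2 FN2 N2y]
          |t [N1 FN1 N1t]].
  - by exists N1 => //; have [_ [NZ _ _]] := inF _ _ FN1 N1x; exact: NZ.
  - have [N12|N21] := Ftot _ _ FN1 FN2.
    + exists N2 => //; have [_ [_ ND _]] := inF _ _ FN2 N2y.
      by apply: ND => //; exact: N12.
    + exists N1 => //; have [_ [_ ND _]] := inF _ _ FN1 N1x.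
      by apply: ND => //; exact: N21.
  - by have [_ [_ _ N0]] := inF _ _ FN1 N1t; exact: N0.
have [CM coneM] : C `<=` M /\ epigraph_cone M.
  case: PM => // M0; exfalso; apply: (Mmax C); last by right; split.
  by rewrite M0; split=> // /(_ _ C00).
exists M; split=> // N coneN MN; apply/not_notP => NM.
by apply: (Mmax N) => //; right; split=> //; exact: subset_trans MN.
Qed.

(** Either the ray through [(x, t)] can be adjoined, and is then already in [M], or a point of [M]
    above [- x] obstructs it. *)
Lemma maximal_cone_dichotomy M : epigraph_cone M -> M (0, 0) ->
  (forall N, epigraph_cone N -> M `<=` N -> N `<=` M) ->
  forall x t, M (x, t) \/ exists2 s, s < - t & M (- x, s).
Proof.
move=> coneM M00 Mmax x t.
have [|/existsNP[s /not_implyP[Ms /negP]]] :=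
    pselect (forall s, M (- x, s) -> - t <= s).
  move=> /(epigraph_cone_adjoin coneM) coneN; left.
  apply: (Mmax _ coneN); first exact: sub_adjoin.
  by have := adjoin_generator (- x) (- t) M00; rewrite !opprK.
by rewrite -ltNge => ts; right; exists s.
Qed.

(* Hahn-Banach: a maximal cone is the epigraph of its lower boundary, up to   *)
(* that boundary, and the dichotomy above makes the boundary odd.             *)
Lemma hahn_banach_cone C : epigraph_cone C -> total_cone C ->
  exists2 Phi, linear_form Phi & forall x t, C (x, t) -> Phi x <= t.
Proof.
move=> coneC totC.
have C00 : C (0, 0).
  have [t C0t] := totC 0; have [CZ _ _] := coneC.
  by have := CZ 0 _ _ (lexx 0) C0t; rewrite scaler0 mul0r.
have [M [CM coneM Mmax]] := maximal_cone coneC C00.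
have M00 := CM _ C00.
have Mdich := maximal_cone_dichotomy coneM M00 Mmax.
have [MZ MD M0] := coneM.
pose S x := [set t | M (x, t)].
have S0 x : S x !=set0 by have [t /CM] := totC x; exists t.
have Slb x : has_lbound (S x).
  have [s Ms] := S0 (- x); exists (- s) => t Mt.
  by have := MD _ _ _ _ Ms Mt; rewrite addNr => /M0; rewrite -lerBlDl sub0r.
pose Phi x := inf (S x).
have PhiM x t : M (x, t) -> Phi x <= t by move=> Mt; exact: ge_inf.
have Phige x m : (forall t, M (x, t) -> m <= t) -> m <= Phi x.
  by move=> h; exact: lb_le_inf.
have PhiD x y : Phi (x + y) <= Phi x + Phi y.
  rewrite -lerBlDr; apply: (Phige x) => s Ms; rewrite lerBlDr -lerBlDl.
  by apply: Phige => t Mt; rewrite lerBlDl; apply: PhiM; exact: MD.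
have Phi0 : Phi 0 = 0 by apply/eqP; rewrite eq_le PhiM// Phige.
have PhiN x : Phi (- x) = - Phi x.
  apply/eqP; rewrite eq_le; apply/andP; split; last first.
    by rewrite lerNl -subr_ge0 opprK -Phi0 -(subrr x) PhiD.
  (* Otherwise the midpoint of [- Phi (- x)] and [Phi x] contradicts both branches of the
     dichotomy. *)
  rewrite lerNr leNgt; apply/negP => /midf_lt[Ns sN].
  have [Ms|[t ts Mt]] := Mdich x ((- Phi (- x) + Phi x) / 2).
    by have := PhiM _ _ Ms; rewrite leNgt sN.
  by have := le_lt_trans (PhiM _ _ Mt) ts; rewrite ltrNr ltNge ltW// .
have {}PhiD x y : Phi (x + y) = Phi x + Phi y.
  apply/eqP; rewrite eq_le PhiD/= -lerBrDr -PhiN.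
  by rewrite -{1}(addrK y x) PhiD.
have PhiZ_le a x : 0 < a -> Phi (a *: x) <= a * Phi x.
  move=> a0; rewrite -ler_pdivrMl//; apply: Phige => t Mt.
  by rewrite ler_pdivrMl//; apply: PhiM; apply: MZ => //; exact: ltW.
have PhiZp a x : 0 < a -> Phi (a *: x) = a * Phi x.
  move=> a0; apply/eqP; rewrite eq_le PhiZ_le//=.
  by rewrite -lerN2 -PhiN -scalerN (le_trans (PhiZ_le _ _ a0))// PhiN mulrN.
have PhiZ a x : Phi (a *: x) = a * Phi x.
  have [a0|a0|->] := ltgtP a 0; [|exact: PhiZp|by rewrite scale0r mul0r Phi0].
  by rewrite -[a]opprK scaleNr PhiN PhiZp ?oppr_gt0// !mulNr.
exists Phi; first by move=> a x y; rewrite PhiD PhiZ.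
by move=> x t /CM; exact: PhiM.
Qed.

(** Adjoining [(- f, - 1)] before applying Hahn-Banach forces the value at [f]. *)
Lemma hahn_banach_cone_at C f : epigraph_cone C -> total_cone C ->
  (forall t, C (f, t) -> 1 <= t) ->
  exists Phi, [/\ linear_form Phi, forall x t, C (x, t) -> Phi x <= t &
    1 <= Phi f].
Proof.
move=> coneC totC Cf.
have C00 : C (0, 0).
  have [t C0t] := totC 0; have [CZ _ _] := coneC.
  by have := CZ 0 _ _ (lexx 0) C0t; rewrite scaler0 mul0r.
have [x|Phi Plin PC] := hahn_banach_cone (epigraph_cone_adjoin coneC Cf).
  by have [t /(@sub_adjoin _ f 1)] := totC x; exists t.
exists Phi; split=> // [x t /(@sub_adjoin _ f 1)|]; first exact: PC.
have := PC _ _ (adjoin_generator f 1 C00).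
have := Plin (-1) f f; rewrite scaleN1r addNr.
have := Plin 1 0 0; rewrite scale1r addr0 mul1r.
have := Plin (-1) f 0; rewrite scaleN1r addr0.
lra.
Qed.

End hahn_banach.

(** * Points of a reflexive space from cones over its dual *)

Lemma linear_form0 (R : realType) (E : lmodType R) (Phi : E -> R) :
  linear_form Phi -> Phi 0 = 0.
Proof.
by move=> /(_ (-1) 0 0); rewrite scaler0 addr0 mulN1r addNr.
Qed.

Lemma linear_formN (R : realType) (E : lmodType R) (Phi : E -> R) :
  linear_form Phi -> forall x, Phi (- x) = - Phi x.
Proof.
move=> Plin x; have := Plin (-1) x 0.
by rewrite scaleN1r addr0 mulN1r linear_form0// addr0.
Qed.

Lemma dual_of_linear_form (R : realType) (E : normedModType R)
    (Phi : E -> R) (K : R) :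
  linear_form Phi -> (forall x, Phi x <= K * `|x|) ->
  exists g : dual E, forall x, g x = Phi x.
Proof.
move=> Plin PhiK.
have gP : (Phi : E -> R^o) \in dual_pred.
  apply/asboolP; split; first by move=> a x y _ _; exact: Plin.
  exists K => x _; rewrite ler_norml PhiK andbT lerNl -linear_formN//.
  by rewrite (le_trans (PhiK _))// normrN.
by exists (Dual gP).
Qed.

(** The points [(g, K * |g|)] in the cone make the Hahn-Banach form bounded, hence an element of the
    bidual. *)
Lemma reflexive_cone (R : realType) (X : normedModType R) (K : R)
    (C : set (dual X * R)) : reflexive_space X -> epigraph_cone C ->
  (forall g, C (g, K * `|g|)) ->
  exists x, forall g t, C (g, t) -> g x <= t.
Proof.
move=> reflX coneC CK.
have [|Phi Plin PC] := hahn_banach_cone coneC.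
  by move=> g; exists (K * `|g|).
have [G GP] := dual_of_linear_form Plin (fun g => PC _ _ (CK g)).
have [x _ xG] := reflX G Logic.I.
by exists x => g t /PC; rewrite -GP -xG.
Qed.

Lemma reflexive_cone_at (R : realType) (X : normedModType R) (K : R)
    (C : set (dual X * R)) (f : dual X) : reflexive_space X ->
  epigraph_cone C -> (forall g, C (g, K * `|g|)) ->
  (forall t, C (f, t) -> 1 <= t) ->
  exists x, (forall g t, C (g, t) -> g x <= t) /\ 1 <= f x.
Proof.
move=> reflX coneC CK Cf.
have [|Phi [Plin PC Phif]] := hahn_banach_cone_at coneC _ Cf.
  by move=> g; exists (K * `|g|).
have [G GP] := dual_of_linear_form Plin (fun g => PC _ _ (CK g)).
have [x _ xG] := reflX G Logic.I.
by exists x; split=> [g t /PC|]; rewrite -?GP -?xG// in Phif *.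
Qed.

(** * Closed subspaces and separation *)

Section subspace.
Context {R : realType} {E : normedModType R} (W : set E).
Hypothesis subW : closed_subspace W.

Lemma subspace0 : W 0.
Proof. by have [_ [W0 _]] := subW; move: W0; rewrite inE. Qed.

Lemma subspaceZD (a : R) u v : W u -> W v -> W (a *: u + v).
Proof.
move=> Wu Wv; have [_ [_ Wlin]] := subW.
by have := Wlin a u v; rewrite !inE; apply.
Qed.

Lemma subspaceD u v : W u -> W v -> W (u + v).
Proof. by move=> Wu Wv; rewrite -[u]scale1r; exact: subspaceZD. Qed.

Lemma subspaceZ (a : R) u : W u -> W (a *: u).
Proof. by move=> Wu; rewrite -[a *: u]addr0; apply: subspaceZD subspace0. Qed.

Lemma subspaceN u : W u -> W (- u).
Proof. by rewrite -scaleN1r; exact: subspaceZ. Qed.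

Lemma linear_on0 (f : E -> R) : linear_on W f -> f 0 = 0.
Proof.
move=> /(_ (-1) 0 0 subspace0 subspace0).
by rewrite scaler0 addr0 mulN1r addNr.
Qed.

Lemma linear_onD (f : E -> R) u v : linear_on W f -> W u -> W v ->
  f (u + v) = f u + f v.
Proof.
by move=> flin Wu Wv; have := flin 1 _ _ Wu Wv; rewrite scale1r mul1r.
Qed.

Lemma linear_onZ (f : E -> R) a u : linear_on W f -> W u ->
  f (a *: u) = a * f u.
Proof.
move=> flin Wu; have := flin a _ _ Wu subspace0.
by rewrite linear_on0// !addr0.
Qed.

Lemma linear_onN (f : E -> R) u : linear_on W f -> W u -> f (- u) = - f u.
Proof. by move=> flin Wu; rewrite -scaleN1r linear_onZ// mulN1r. Qed.

(** Hahn-Banach below dist(., W) / d, where d > 0 is a lower bound for the distance from [x] to [W]: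
    such a form is at most 0 on the subspace [W], hence vanishes there, and can be at least 1 at
    [x]. *)
Lemma separation_closed_subspace (x : E) : ~ W x ->
  exists2 g : dual E, (forall w, W w -> g w = 0) & g x != 0.
Proof.
move=> Wx; have [closedW _] := subW.
have [d d0 xd] : exists2 d : R, 0 < d & forall w, W w -> d <= `|x - w|.
  have /nbhs_ballP[d /= d0 dW] : nbhs x (~` W).
    by apply: open_nbhs_nbhs; split=> //; exact: closed_openC.
  exists d => // w Ww; rewrite leNgt; apply/negP => xw.
  by apply: (dW w) => //; rewrite -ball_normE.
pose C : set (E * R) := [set p | exists2 w, W w & `|p.1 - w| <= d * p.2].
have C0 w : W w -> C (w, 0).
  by move=> Ww; exists w; rewrite //= subrr normr0 mulr0.
have coneC : epigraph_cone C.
  split=> [a y t a0 [w Ww /= wt]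
          |y z s t [w Ww /= wt] [v Wv /= vt]
          |t [w _ /= wt]].
  - exists (a *: w); first exact: subspaceZ.
    by rewrite /= -scalerBr normrZ ger0_norm// mulrCA ler_wpM2l.
  - exists (w + v); first exact: subspaceD.
    by rewrite /= opprD addrACA mulrDr (le_trans (ler_normD _ _))// lerD.
  - by rewrite -(pmulr_rge0 _ d0) (le_trans _ wt).
have CK y : C (y, d^-1 * `|y|).
  by exists 0; rewrite /= ?subr0 ?mulVKf ?gt_eqF//; exact: subspace0.
have [||Phi [Plin PC Phix]] := @hahn_banach_cone_at _ _ C x coneC.
- by move=> y; exists (d^-1 * `|y|).
- move=> t [w Ww /= wt]; rewrite -(ler_pM2l d0) mulr1.
  exact: le_trans (xd _ Ww) wt.
have [g gP] := dual_of_linear_form Plin (fun y => PC _ _ (CK y)).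
exists g => [w Ww|]; rewrite gP; last by rewrite gt_eqF// (lt_le_trans _ Phix).
have := PC _ _ (C0 _ (subspaceN Ww)); rewrite linear_formN// oppr_le0 => Phiw.
by apply/eqP; rewrite eq_le Phiw andbT; apply: PC (C0 _ Ww).
Qed.

End subspace.

Section dual_evaluation.
Context {R : realType} {E : normedModType R}.
Implicit Types (f : dual E) (x : E).

Lemma dual_oppE f x : (- f) x = - f x. Proof. by []. Qed.

Lemma dual_scaleE (a : R) f x : (a *: f) x = a * f x. Proof. by []. Qed.

End dual_evaluation.

(** * The adjoint estimate on a single pair of subspaces *)

Section inf_sup.
Context {R : realType} {X : normedModType R} {Y : completeNormedModType R}.
Variables (Z : set X) (W : set Y) (A : X -> Y -> R) (c : R).
Hypothesis reflX : reflexive_space X.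
Hypotheses (subZ : closed_subspace Z) (subW : closed_subspace W).
Hypothesis A_bilinear : bounded_bilinear_form Z W A.
Hypothesis A_dual : forall w, W w -> bounded_linear_functional setT (A ^~ w).
Hypothesis A_nondegenerate : nondegenerate_snd Z W A.
Hypothesis c_gt0 : 0 < c.
Hypothesis A_coercive :
  forall x, Z x -> (forall w, W w -> `|A x w| <= `|w|) -> c * `|x| <= 1.

Let A_linr z : Z z -> linear_on W (A z).
Proof. by have [_ + _] := A_bilinear; exact. Qed.

(* If [f] is not a limit of functionals [A ^~ w] with [w] in the unit ball of *)
(* [W], then some [x] separates it from them. Such an [x] lies in [Z], and    *)
(* [A_coercive] at [x] gives [c <= k].                                        *)
Lemma approximation (f : dual X) (k d : R) : 0 < d -> k < c ->
  (forall z, Z z -> `|f z| <= k * `|z|) ->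
  exists w, [/\ W w, `|w| <= 1 &
    forall z, Z z -> `|f z - A z w| <= d * `|z|].
Proof.
move=> d0 kc fk; apply: contrapT => Nw.
(* Epigraph, up to boundary, of g |-> inf over w in W of |w| + |g - A(., w)| / d, the second norm
   being taken on [Z]. A height below 1 at [f] would give the [w] excluded by [Nw]. *)
pose C := [set p : dual X * R | exists (w : Y) (s : R), [/\ W w, 0 <= s,
  forall z, Z z -> `|p.1 z - A z w| <= s * `|z| & s + d * `|w| <= d * p.2]].
have coneC : epigraph_cone C.
  split=> [a g t a0 [w [s [Ww s0 gs st]]]
          |g h t u [w [s [Ww s0 gs st]]] [v [r [Wv r0 hr ru]]]
          |t [w [s [Ww s0 gs st]]]].
  - exists (a *: w), (a * s); split; [exact: subspaceZ|exact: mulr_ge0| |].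
      move=> z Zz; rewrite -[dual_fun _ z]/(a * g z).
      rewrite (linear_onZ subW)//; last exact: A_linr.
      by rewrite -mulrBr normrM ger0_norm// -mulrA ler_wpM2l// gs.
    by rewrite /= normrZ ger0_norm// mulrCA -mulrDr mulrCA ler_wpM2l.
  - exists (w + v), (s + r); split; [exact: subspaceD|exact: addr_ge0| |].
      move=> z Zz; rewrite -[dual_fun _ z]/(g z + h z).
      rewrite (linear_onD (A_linr Zz))//.
      rewrite opprD addrACA mulrDl (le_trans (ler_normD _ _))// lerD//.
        exact: gs.
      exact: hr.
    rewrite /= in st ru *; have := ler_wpM2l (ltW d0) (ler_normD w v).
    lra.
  - rewrite /= in st; rewrite -(pmulr_rge0 _ d0) (le_trans _ st)//.
    by rewrite addr_ge0// mulr_ge0// ltW.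
have C_image w : W w -> forall g : dual X, (forall z, Z z -> g z = A z w) ->
    C (g, `|w|).
  move=> Ww g gw; exists w, 0; split=> //; last by rewrite add0r.
  by move=> z Zz; rewrite /= gw// subrr normr0 mul0r.
have W0 := subspace0 subW.
have CK g : C (g, d^-1 * `|g|).
  exists 0, `|g|; split=> //=.
    move=> z Zz; rewrite (linear_on0 subW)//; last exact: A_linr.
    by rewrite subr0; exact: dual_normP.
  by rewrite normr0 mulr0 addr0 mulVKf ?gt_eqF.
have [|x [xC fx]] := reflexive_cone_at (f := f) reflX coneC CK.
  move=> t [w [s [Ww s0 fs /= st]]]; rewrite leNgt; apply/negP => t1.
  have sdt : s <= d * t by rewrite (le_trans _ st)// lerDl mulr_ge0// ltW.
  have wdt : d * `|w| <= d * t by rewrite (le_trans _ st)// lerDr.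
  apply: Nw; exists w; split=> // [|z Zz].
    by rewrite -(ler_pM2l d0) (le_trans wdt)// ler_pM2l// ltW.
  rewrite (le_trans (fs z Zz))// ler_wpM2r// (le_trans sdt)//.
  by rewrite ger_pMr// ltW.
(* Functionals vanishing on [Z] have height 0 in [C] (take w = 0), so they vanish at [x]. *)
have Zx : Z x.
  apply: contrapT => /(separation_closed_subspace subZ)[g gZ gx].
  have Cg (h : dual X) : (forall z, Z z -> h z = 0) -> C (h, 0).
    move=> hZ; rewrite -(normr0 Y); apply: C_image => // z Zz.
    by rewrite hZ// (linear_on0 subW)//; exact: A_linr.
  have gx_le0 := xC _ _ (Cg _ gZ).
  have gx_ge0 : (- g) x <= 0.
    by apply: xC; apply: Cg => z Zz; rewrite dual_oppE gZ// oppr0.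
  by case/eqP: gx; apply/le_anti/andP; rewrite -oppr_le0.
have Ax w : W w -> A x w <= `|w|.
  move=> Ww; have Wlin := A_dual Ww.
  have SP : (A ^~ w : X -> R^o) \in dual_pred by apply/asboolP.
  by have := xC _ _ (C_image _ Ww (Dual SP) (fun _ _ => erefl)).
have cx : c * `|x| <= 1.
  apply: A_coercive => // w Ww; rewrite ler_norml Ax// andbT lerNl.
  rewrite -(linear_onN subW (A_linr Zx))//.
  by rewrite (le_trans (Ax _ (subspaceN subW Ww)))// normrN.
have kx := fk x Zx.
have x0 : 0 < `|x|.
  rewrite normr_gt0; apply/eqP => x0.
  by move: fx; rewrite x0 dual0 leNgt ltr01.
have := ler_norm (f x); have : k * `|x| < c * `|x| by rewrite ltr_pM2r.
lra.
Qed.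

(** Dividing by [a = 2 * k / c] brings A(., w) to norm at most c / 2 < c on [Z]. An approximant [u]
    within c / 4 then leaves an error of at most a * c / 4 = k / 2 for [v = w - a *: u]. *)
Lemma contraction_step (w : Y) (k : R) : W w -> 0 < k ->
  (forall z, Z z -> `|A z w| <= k * `|z|) ->
  exists v, [/\ W v, `|v - w| <= 2 * k / c &
    forall z, Z z -> `|A z v| <= k / 2 * `|z|].
Proof.
move=> Ww k0 wk; pose a := 2 * k / c.
have a0 : 0 < a by rewrite divr_gt0// mulr_gt0.
have SP : (A ^~ w : X -> R^o) \in dual_pred by apply/asboolP; exact: A_dual.
have [||z Zz|u [Wu u1 fu]] :=
  @approximation (a^-1 *: Dual SP) (c / 2) (c / 4).
- by rewrite divr_gt0.
- by rewrite ltr_pdivrMr// ltr_pMr// ltr1n.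
- rewrite dual_scaleE normrM gtr0_norm ?invr_gt0// ler_pdivrMl//.
  rewrite (le_trans (wk _ Zz))//= /a mulrA ler_wpM2r//.
  by rewrite le_eqVlt; apply/orP; left; apply/eqP; field; rewrite gt_eqF.
exists (- a *: u + w); split=> [||z Zz].
- exact: subspaceZD.
- by rewrite addrK scaleNr normrN normrZ gtr0_norm// ger_pMr.
- rewrite A_linr//.
  have -> : - a * A z u + A z w = a * (a^-1 * A z w - A z u).
    by rewrite mulrBr mulrA divff ?gt_eqF// mul1r mulNr addrC.
  rewrite normrM gtr0_norm// -ler_pdivlMl// (le_trans (fu z Zz))//.
  rewrite mulrA ler_wpM2r// /a.
  by rewrite le_eqVlt; apply/orP; left; apply/eqP; field; rewrite !gt_eqF.
Qed.

(** Iterating [contraction_step] from [w] halves the functional each time, while the displacements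
    sum to at most 4 * k / c. The limit is annihilated by all of [Z], so it is 0, and |w| is the
    total displacement. *)
Lemma inf_sup (w : Y) (k : R) : W w -> 0 < k ->
  (forall z, Z z -> `|A z w| <= k * `|z|) -> c * `|w| <= 4 * k.
Proof.
move=> Ww k0 wk.
pose small (p : Y * R) := [/\ W p.1, 0 < p.2 &
  forall z, Z z -> `|A z p.1| <= p.2 * `|z|].
(* Guarded by [small p] so that every pair has a successor, as dependent choice requires. *)
pose step (p q : Y * R) := small p ->
  [/\ small q, `|q.1 - p.1| <= 2 * p.2 / c & q.2 = p.2 / 2].
have step_ex p : {q | step p q}.
  apply: cid; have [sp|nsp] := pselect (small p); last by exists p.
  have [Wp p0 pk] := sp; have [v [Wv vp vk]] := contraction_step Wp p0 pk.
  by exists (v, p.2 / 2) => _; split=> //; split=> //=; rewrite divr_gt0.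
have [p [p0 pS]] := dependent_choice step_ex (w, k).
have ps n : small (p n).
  by elim: n => [|n /pS[]//]; rewrite p0.
have p2 n : (p n).2 = k * 2^-1 ^+ n.
  elim: n => [|n IHn]; first by rewrite p0 expr0 mulr1.
  by have [_ _ ->] := pS n (ps n); rewrite IHn exprSr mulrA.
pose u n := (p n).1.
have du n : `|u n.+1 - u n| <= geometric (2 * k / c) 2^-1 n.
  by have [_ + _] := pS n (ps n); rewrite p2 /= mulrA mulrAC.
have half_lt1 : `|2^-1 : R| < 1 by rewrite gtr0_norm// invf_lt1// ltr1n.
have cvg_u : cvgn u.
  rewrite [u](_ : _ = (fun n => u 0 + series (telescope u) n)); last first.
    by apply/funext => n; exact: eq_sum_telescope.
  apply: is_cvgD; first exact: is_cvg_cst.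
  apply: normed_cvg; apply: series_le_cvg du _ => // [n|].
    by rewrite /= mulr_ge0// ?exprn_ge0// divr_ge0// ?mulr_ge0// ltW.
  exact: is_cvg_geometric_series.
pose l := limn u.
have lu : forall e, 0 < e -> \forall n \near \oo, `|l - u n| <= e.
  by apply/cvgrPdist_le; exact: cvg_u.
have Wl : W l.
  apply: (closed_cvg W _ _ _ cvg_u); first by case: subW.
  by near=> n; have [] := ps n.
have Al0 z : Z z -> A z l = 0.
  move=> Zz; have [_ _ [M AM]] := A_bilinear.
  apply/eqP; rewrite -normr_le0; apply/ler_addgt0Pl => e e0; rewrite addr0.
  have e20 : 0 < e / 2 by rewrite divr_gt0.
  pose m := `|M| * `|z| + 1.
  have m0 : 0 < m by rewrite ltr_wpDl// mulr_ge0.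
  have geo_small : \forall n \near \oo, k * 2^-1 ^+ n * `|z| <= e / 2.
    have /cvgrPdist_le/(_ _ e20) := @cvg_geometric R (k * `|z|) _ half_lt1.
    apply: filterS => n; rewrite sub0r normrN; apply: le_trans.
    by rewrite mulrAC; exact: ler_norm.
  near \oo => n.
  have [Wn pn0 pn] := ps n; have Wln := subspaceD subW Wl (subspaceN subW Wn).
  have lun : `|l - u n| <= e / 2 / m.
    by near: n; apply: lu; rewrite divr_gt0.
  have pnz : (p n).2 * `|z| <= e / 2.
    by rewrite p2; near: n.
  rewrite -(subrK (u n) l) (linear_onD (A_linr Zz))//.
  rewrite (le_trans (ler_normD _ _))// [e]splitr lerD//; last first.
    exact: le_trans (pn _ Zz) pnz.
  rewrite (le_trans (AM _ _ Zz Wln))//.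
  have Mm : M * `|z| <= m.
    by rewrite (le_trans (ler_wpM2r _ (ler_norm M)))// lerDl.
  rewrite (le_trans (ler_wpM2r (normr_ge0 _) Mm))//.
  by rewrite -ler_pdivlMl// mulrC.
have l0 : l = 0.
  apply: contrapT => /eqP /(A_nondegenerate Wl)[z Zz].
  by rewrite Al0// eqxx.
have uw n : `|u n - w| <= 4 * k / c * (1 - 2^-1 ^+ n).
  elim: n => [|n IHn].
    by rewrite /u p0 subrr normr0 expr0 subrr mulr0.
  rewrite -(subrK (u n) (u n.+1)) -addrA (le_trans (ler_normD _ _))//.
  rewrite (le_trans (lerD (du n) IHn))// exprS /=.
  by rewrite le_eqVlt; apply/orP; left; apply/eqP; field; rewrite gt_eqF.
rewrite -ler_pdivlMl// mulrC; apply/ler_addgt0Pl => e e0.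
near \oo => n.
have : `|l - u n| <= e by near: n; exact: lu.
rewrite l0 sub0r normrN => une.
have -> : w = u n - (u n - w) by rewrite opprB addrC subrK.
rewrite (le_trans (ler_normB _ _))// lerD// (le_trans (uw n))//.
rewrite ler_piMr ?gerBl ?exprn_ge0//.
by rewrite divr_ge0// ?mulr_ge0// ltW.
Unshelve. all: by end_near. Qed.

End inf_sup.

(** Passes from the supremum in (d) to the unit-ball form used by [inf_sup], and reaches [k = 0] by
    letting e tend to 0. *)
Lemma inf_sup_ge0 (R : realType) (X : normedModType R)
    (Y : completeNormedModType R) (Z : set X) (W : set Y) (A : X -> Y -> R)
    (c : R) : reflexive_space X ->
  closed_subspace Z -> closed_subspace W -> bounded_bilinear_form Z W A ->
  (forall w, W w -> bounded_linear_functional setT (A ^~ w)) ->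
  nondegenerate_snd Z W A -> 0 < c ->
  (forall x, Z x ->
    c * `|x| <= sup [set `|A x y| | y in [set y | W y /\ `|y| = 1]]) ->
  forall (w : Y) (k : R), W w -> 0 <= k ->
    (forall z, Z z -> `|A z w| <= k * `|z|) -> c * `|w| <= 4 * k.
Proof.
move=> reflX subZ subW bilA dualA nondegA c0 supA w k Ww k0 wk.
apply/ler_addgt0Pr => e e0.
have -> : 4 * k + e = 4 * (k + e / 4) by field.
have ke0 : 0 < k + e / 4 by rewrite ltr_wpDl// divr_gt0.
apply: (inf_sup reflX subZ subW bilA) => // [x Zx xW|z Zz].
  apply: le_trans (supA x Zx) _.
  (* If [W] has no unit vector, the supremum takes its default value 0. *)
  have [->|/set0P S0] :=
    eqVneq [set `|A x y| | y in [set y | W y /\ `|y| = 1]] set0.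
    by rewrite sup0.
  by apply: ge_sup => // _ [y [Wy y1] <-]; rewrite -y1 xW.
by rewrite (le_trans (wk z Zz))// ler_wpM2r// lerDl divr_ge0// ltW.
Qed.

(** * Gluing the uniform estimates along the directed set *)

Theorem theorem2p3 (R : realType) (X Y : completeNormedModType R)
    (reflexiveX : reflexive_space X)
    (L : Type) (le : L -> L -> Prop) (directedL : directed_set le)
    (X_ : L -> set X) (Y_ : L -> set Y)
    (closedX_ : forall l, closed_subspace (X_ l))
    (closedY_ : forall l, closed_subspace (Y_ l))
    (directedY_ : upwards_directed le Y_)
    (V : set Y) (V_def : V = \bigcup_l Y_ l)
    (A : X -> Y -> R)
    (hypa : forall l, bounded_bilinear_form (X_ l) (Y_ l) A)
    (hypb : forall v, V v -> bounded_linear_functional setT (A ^~ v))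
    (hypc : forall l, nondegenerate_snd (X_ l) (Y_ l) A)
    (hypd : exists2 c : R, 0 < c &
      forall l x, X_ l x ->
        c * `|x| <= sup [set `|A x y| | y in [set y | Y_ l y /\ `|y| = 1]])
    (vstar : Y -> R) (bounded_vstar : bounded_linear_functional V vstar) :
  exists x : X, forall v, V v -> A x v = vstar v.
Proof.
have [[l_] le_refl le_trans_ le_dir] := directedL.
have [c c0 supA] := hypd.
have [vlin [M vM]] := bounded_vstar.
have YV l w : Y_ l w -> V w by rewrite V_def => Yw; exists l.
have dualA l w : Y_ l w -> bounded_linear_functional setT (A ^~ w).
  by move=> /YV; exact: hypb.
(* [A x] need not be linear on [V] for a general [x], so that functionals are *)
(* identified with elements of [V] only through their traces on the [X_ m].   *)
pose G (f : dual X) (w : Y) := exists l, forall m, le l m ->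
  Y_ m w /\ forall z, X_ m z -> f z = A z w.
have GV f w : G f w -> V w.
  by move=> [l /(_ l (le_refl l))[Yw _]]; exact: YV Yw.
have G0 : G 0 0.
  exists l_ => m _; split; first exact: subspace0 (closedY_ m).
  move=> z Xz; have [_ linA _] := hypa m.
  by rewrite (linear_on0 (closedY_ m))//; exact: linA.
have GZD a f w g v : G f w -> G g v -> G (a *: f + g) (a *: w + v).
  move=> [l1 fw] [l2 gv]; have [l l1l l2l] := le_dir l1 l2.
  exists l => m lm.
  have [Yw fA] := fw m (le_trans_ _ _ _ l1l lm).
  have [Yv gA] := gv m (le_trans_ _ _ _ l2l lm).
  split=> [|z Xz]; first exact: (subspaceZD (closedY_ m)).
  have [_ linA _] := hypa m.
  by rewrite linA// -fA// -gA.
pose K := 4 * `|M| / c.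
(* On a single X_l, [f] and A(., w) agree, so the adjoint estimate bounds |w| by 4 * |f| / c with
   the same c for every l. *)
have GK f w : G f w -> `|vstar w| <= K * `|f|.
  move=> Gfw; have [l /(_ l (le_refl l))[Yw fA]] := Gfw.
  have cw : c * `|w| <= 4 * `|f|.
    apply: (inf_sup_ge0 reflexiveX (closedX_ l) (closedY_ l) (hypa l)
      (dualA l) (hypc l) c0 (supA l)) => // z Xz.
    by rewrite -fA//; exact: dual_normP.
  rewrite (le_trans (vM _ (GV _ _ Gfw)))//.
  rewrite (le_trans (ler_wpM2r (normr_ge0 _) (ler_norm M)))//.
  have -> : K * `|f| = `|M| * (c^-1 * (4 * `|f|)).
    by rewrite /K; field; rewrite gt_eqF.
  by rewrite ler_wpM2l// ler_pdivlMl.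
have K0 : 0 <= K by rewrite divr_ge0// ?mulr_ge0// ltW.
(* Epigraph, up to boundary, of g |-> inf of K * |g - f| + v*(w) over [G f w]: a linear form below
   it is bounded by K and lies below v* along [G]. Applied to v and -v, this yields equality. *)
pose C := [set p : dual X * R | exists f w,
  G f w /\ K * `|p.1 - f| + vstar w <= p.2].
have vstar0 : vstar 0 = 0.
  have := vlin (-1) 0 0 (GV _ _ G0) (GV _ _ G0).
  by rewrite scaler0 addr0 mulN1r addNr.
have CG f w : G f w -> C (f, vstar w).
  by move=> Gfw; exists f, w; rewrite subrr normr0 mulr0 add0r.
have coneC : epigraph_cone C.
  split=> [a g t a0 [f [w [Gfw /= fwt]]]
          |g h s t [f [w [Gfw /= fws]]] [f' [w' [Gfw' /= fwt]]]
          |t [f [w [Gfw /= fwt]]]].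
  - exists (a *: f), (a *: w); split.
      by rewrite -[a *: f]addr0 -[a *: w]addr0; exact: GZD.
    rewrite /= -scalerBr normrZ ger0_norm// -[a *: w]addr0 vlin//; first last.
    - exact: GV G0.
    - exact: GV Gfw.
    by rewrite vstar0 addr0 mulrCA -mulrDr ler_wpM2l.
  - exists (f + f'), (w + w'); split.
      by rewrite -[f]scale1r -[w]scale1r; exact: GZD.
    rewrite /= -[w]scale1r vlin//; first last.
    - exact: GV Gfw'.
    - exact: GV Gfw.
    rewrite mul1r opprD addrACA.
    have := ler_wpM2l K0 (ler_normD (g - f) (h - f')).
    lra.
  - rewrite (le_trans _ fwt)// sub0r normrN -lerBlDr sub0r.
    by rewrite (le_trans _ (GK _ _ Gfw))// -normrN ler_norm.
have CK g : C (g, K * `|g|).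
  by exists 0, 0; rewrite /= subr0 vstar0 addr0.
have [x xC] := reflexive_cone reflexiveX coneC CK.
exists x => v Vv.
have SP : (A ^~ v : X -> R^o) \in dual_pred by apply/asboolP; exact: hypb.
have Gv : G (Dual SP) v.
  move: (Vv); rewrite V_def => -[l _ Yv].
  by exists l => m lm; split=> //; exact: directedY_ Yv.
have Gv' : G (- Dual SP) (- v).
  have := GZD (-1) _ _ _ _ Gv G0.
  by rewrite !addr0 !scaleN1r.
have := xC _ _ (CG _ _ Gv').
rewrite dual_oppE -[- v]addr0 -[- v]scaleN1r vlin//.
  rewrite vstar0 addr0 mulN1r lerN2 => vA.
  by apply/le_anti/andP; split=> //; exact: xC (CG _ _ Gv).
exact: GV G0.
Qed.
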